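(* Let $\kappa$ be an infinite cardinal and let $M$ be a nonempty subset of $\beta\kappa$. For any $T_1$-space $X$ the pair $(\mathsf W^\sharp_M X,j_X)$ has the following properties. (1) The identity map $\mathsf W^\sharp_M X\to \mathsf W_M X$ is continuous. (2) The identity map $\mathsf W_M X\to \mathsf W^\sharp_M X$ is $[M]$-continuous. (3) The map $j_X:X\to\mathsf W^\sharp_M X$ is a topological embedding. (4) The set $j_X(X)$ is dense in $\mathsf W^\sharp_M X$. (5) The space $\mathsf W^\sharp_M X$ is $M$-compact. (6) If the space $X$ is $\overline{\kappa}$-normal, then the space $\mathsf W^\sharp_M X$ is Hausdorff and $\overline{\kappa}$-Urysohn. (7) If the space $\mathsf W_M X$ is Hausdorff, then any $M$-compact subspace of $\mathsf W_M X\setminus j_X(X)$ is closed in $\mathsf W^\sharp_M X$. (8) For any continuous map $f:X\to Y$ to a $\overline{\kappa}$-Urysohn $M$-compact $T_1$-space $Y$ there exists a unique continuous map $\bar f:\mathsf W^\sharp_M X\to Y$ such that $f=\bar f\circ j_X$. (9) If $X$ contains no long $\kappa$-butterflies, then for any continuous map $f:X\to Y$ to a Hausdorff $M$-compact space $Y$ there exists a unique continuous map $\bar f:\mathsf W^\sharp_M X\to Y$ such that $f=\bar f\circ j_X$. (10) If $X$ is $\overline{\kappa}$-normal, then $(\mathsf W^\sharp_M X,j_X)$ is a reflection of $X$ in the class $\mathsf U_M$ of $\overline{\kappa}$-Urysohn $M$-compact spaces. (11) If $X$ is $\overline{\kappa}$-normal and contains no long $\kappa$-butterflies, then $(\mathsf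 W^\sharp_M X,j_X)$ is a reflection of $X$ in the class $\mathsf H_M$ of Hausdorff $M$-compact spaces.
   Context: Reflection: for a class $\mathsf T$ of topological spaces, a reflection of a space $X$ in $\mathsf T$ is a pair $(\mathsf TX,i_X)$ of a space $\mathsf TX\in\mathsf T$ and a continuous map $i_X:X\to\mathsf TX$ such that for any continuous map $f:X\to Y$ to a space $Y\in\mathsf T$ there is a unique continuous map $\bar f:\mathsf TX\to Y$ with $f=\bar f\circ i_X$. $\kappa$ carries the discrete topology; $\beta\kappa$ is its Stone-Čech compactification, i.e. the compact Hausdorff space of all ultrafilters on $\kappa$ (points of $\kappa$ identified with principal ultrafilters), with base of sets $\{p:R\in p\}$, $R\subset\kappa$. For $p\in\beta\kappa$ and a function $x:\kappa\to Z$ into a topological space, $\lim_p x$ is the set of points $\bar x\in Z$ such that $x^{-1}(U)\in p$ for every neighborhood $U$ of $\bar x$. For a nonempty $N\subset\beta\kappa$: a space $Z$ is $N$-compact if $\lim_p x\ne\emptyset$ for all $p\in N$, $x:\kappa\to Z$; a set $A\subset Z$ is $N$-closed in $Z$ if $\lim_p x\subset A$ for all $x:\kappa\to A$ and $p\in N$; the $N$-closure $\mathrm{cl}_N A$ of $A$ in $Z$ is the smallest $N$-closed subset of $Z$ containing $A$; a function $f:Z\to Y$ is $N$-continuous if $f(\lim_p z)\subset\lim_p(f\circ z)$ for all $p\in N$, $z\in Z^\kappa$. $[M]$ denotes the $M$-closure of $\kappa$ in $\beta\kappa$. A $T_1$-space is a space in which all finite subsets are closed. A space $X$ is $\overline{\kappa}$-Urysohn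 if for any $C\subset X$ with $|C|\le\kappa$ and distinct points $x,y\in X$ there are disjoint open sets $V,W$ in $X$ with $x\in V$, $y\in W$ and $\overline{V\cap C}\cap\overline{W\cap C}=\emptyset$. $X$ is $\overline{\kappa}$-normal if for any $C\subset X$ with $|C|\le\kappa$ and any disjoint closed sets $A,B\subset\overline C$ there are disjoint open sets $V,W\subset X$ with $A\subset V$, $B\subset W$. A butterfly in $X$ is a pair $(U,V)$ of disjoint open sets with $\overline U\cap\overline V\ne\emptyset$; it is a long $\kappa$-butterfly if there are subsets $A\subset U$, $B\subset V$ of cardinality $\le\kappa$ such that $\overline A\cap\overline B\neq\emptyset$ and the space $\overline A\cap\overline B$ is not compact. Wallman extension: $\mathsf WX$ is the set of closed ultrafilters on $X$, i.e. families $\mathcal F$ of closed subsets of $X$ such that $\emptyset\notin\mathcal F$; $A\cap B\in\mathcal F$ for all $A,B\in\mathcal F$; and a closed set $F\subset X$ belongs to $\mathcal F$ if $F\cap A\neq\emptyset$ for every $A\in\mathcal F$. Its topology is generated by the base of sets $\langle U\rangle=\{\mathcal F\in\mathsf WX:\exists F\in\mathcal F\ (F\subset U)\}$, $U$ open in $X$. For a $T_1$-space $X$, $j_X:X\to\mathsf WX$ sends $x$ to the family of all closed sets containing $x$. $\mathsf W_MX$ is the $[M]$-closure of $j_X(X)$ in $\mathsf WX$, with the subspace topology. $\tau^\sharp_M$ is the topology on $\mathsf W_MX$ consisting of the sets $U\subset\mathsf W_MX$ such that $j_X^{-1}(U)$ is open in $X$ and $\mathsf W_MX\setminus U$ is $[M]$-closed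 in $\mathsf W_MX$. $\mathsf W^\sharp_MX:=(\mathsf W_MX,\tau^\sharp_M)$, and $j_X$ is regarded as a map into it. *)

(* Defs.v *)
From HB Require Import structures.
From mathcomp Require Import all_boot.
From mathcomp Require Import all_classical.
From mathcomp Require Import topology.

Set Implicit Arguments.
Unset Strict Implicit.
Unset Printing Implicit Defensive.

Local Open Scope classical_set_scope.
Local Open Scope card_scope.

(** A cardinal kappa is represented by a type [K] of that cardinality, so that
    [|C| <= kappa] reads [C #<= [set: K]]. *)

(** Ultrafilters on the discrete space [K]: its Stone-Cech compactification. *)

Record beta (K : Type) := Beta {
  beta_filter : set_system K;
  beta_ultra : UltraFilter beta_filter }.

HB.instance Definition _ (K : Type) := gen_eqMixin (beta K).
HB.instance Definition _ (K : Type) := gen_choiceMixin (beta K).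

Section BetaTopology.
Variable K : Type.

Definition beta_basic (R : set K) : set (beta K) := [set p | beta_filter p R].

Let beta_cover : \bigcup_(R in [set: set K]) beta_basic R = setT.
Proof.
apply/seteqP; split=> // p _; exists setT => //.
have pU := beta_ultra p; exact: filterT.
Qed.

Let beta_join (R S : set K) (p : beta K) :
  [set: set K] R -> [set: set K] S -> beta_basic R p -> beta_basic S p ->
  exists T, [/\ [set: set K] T, beta_basic T p &
                beta_basic T `<=` beta_basic R `&` beta_basic S].
Proof.
move=> _ _ pR pS; exists (R `&` S); split=> //.
  by have pU := beta_ultra p; exact: filterI.
move=> q qRS; have qU := beta_ultra q.
by split; apply: filterS qRS => x [].
Qed.

HB.instance Definition _ :=
  isBaseTopological.Build (beta K) beta_cover beta_join.

End BetaTopology.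

Definition beta_principal (K : Type) (k : K) : beta K :=
  Beta (principal_filter_ultra k).

Section UltrafilterLimits.
Variable K : Type.

Definition plim (Z : topologicalType) (p : beta K) (x : K -> Z) : set Z :=
  [set z | x @ beta_filter p --> z].

Definition Ncompact (N : set (beta K)) (Z : topologicalType) : Prop :=
  forall (p : beta K) (x : K -> Z), N p -> plim p x !=set0.

Definition Nclosed (N : set (beta K)) (Z : topologicalType) (A : set Z) :
  Prop :=
  forall (p : beta K) (x : K -> Z),
    N p -> (forall k, A (x k)) -> plim p x `<=` A.

Definition Nclosure (N : set (beta K)) (Z : topologicalType) (A : set Z) :
  set Z := smallest (@Nclosed N Z) A.

Definition Ncontinuous (N : set (beta K)) (Z Y : topologicalType)
  (f : Z -> Y) : Prop :=
  forall (p : beta K) (z : K -> Z),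
    N p -> f @` plim p z `<=` plim p (f \o z).

(** The [M]-closure of [K] in [beta K], points of [K] being identified with
    principal ultrafilters; usually written as [M] in square brackets. *)
Definition hull (M : set (beta K)) : set (beta K) :=
  Nclosure M (range (@beta_principal K)).

Lemma plim_eq_near (Z : topologicalType) (p : beta K) (x y : K -> Z) :
  beta_filter p [set k | x k = y k] -> plim p x `<=` plim p y.
Proof.
move=> pxy z xz U /xz; rewrite /= /fmap /= => pU.
have pF := beta_ultra p.
by apply: filterS (filterI pxy pU) => k [/= <-].
Qed.

Lemma Nclosed_set0 (N : set (beta K)) (Z : topologicalType) :
  Nclosed N (set0 : set Z).
Proof.
move=> p x _ x0; have pF := beta_ultra p.
by have [k _] := @filter_ex _ (beta_filter p) _ _ filterT; case: (x0 k).
Qed.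

Lemma Nclosed_bigcap (N : set (beta K)) (Z : topologicalType) (I : Type)
    (D : set I) (A : I -> set Z) :
  (forall i, D i -> Nclosed N (A i)) -> Nclosed N (\bigcap_(i in D) A i).
Proof.
by move=> Acl p x Np xA z pxz i Di; apply: (Acl _ Di p x) => // k; exact: xA.
Qed.

Lemma NclosedU (N : set (beta K)) (Z : topologicalType) (A B : set Z) :
  Nclosed N A -> Nclosed N B -> Nclosed N (A `|` B).
Proof.
have main (C D : set Z) p x : Nclosed N C -> N p -> beta_filter p (x @^-1` C) ->
    plim p x `<=` C.
  move=> Ccl Np pC; have pF := beta_ultra p.
  have [k0 Ck0] := @filter_ex _ (beta_filter p) _ _ pC.
  pose y k := if pselect (C (x k)) then x k else x k0.
  apply: (@subset_trans _ (plim p y)).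
    by apply: plim_eq_near; apply: filterS pC => k /= Ck; rewrite /y; case: pselect.
  by apply: Ccl => // k; rewrite /y; case: pselect.
move=> Acl Bcl p x Np xAB; have pF := beta_ultra p.
have [pA|pnA] := in_ultra_setVsetC (x @^-1` A) pF.
  by move=> z /(main _ A _ _ Acl Np pA); left.
suff pB : beta_filter p (x @^-1` B) by move=> z /(main _ B _ _ Bcl Np pB); right.
by apply: filterS pnA => k /= nA; case: (xAB k).
Qed.

Lemma Nclosure_closed (N : set (beta K)) (Z : topologicalType) (A : set Z) :
  Nclosed N (Nclosure N A).
Proof. by apply: Nclosed_bigcap => B []. Qed.

End UltrafilterLimits.

Section KappaProperties.
Variables (K : Type) (X : topologicalType).

Definition kurysohn : Prop :=
  forall C : set X, C #<= [set: K] -> forall x y : X, x <> y ->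
  exists V W : set X,
    [/\ open V, open W, V `&` W = set0, V x & W y] /\
    closure (V `&` C) `&` closure (W `&` C) = set0.

Definition knormal : Prop :=
  forall C : set X, C #<= [set: K] -> forall A B : set X,
    closed A -> closed B -> A `<=` closure C -> B `<=` closure C ->
    A `&` B = set0 ->
  exists V W : set X,
    [/\ open V, open W, V `&` W = set0, A `<=` V & B `<=` W].

Definition butterfly (U V : set X) : Prop :=
  [/\ open U, open V, U `&` V = set0 & closure U `&` closure V !=set0].

Definition long_kbutterfly (U V : set X) : Prop :=
  butterfly U V /\
  exists A B : set X,
    [/\ A `<=` U, B `<=` V, A #<= [set: K] & B #<= [set: K]] /\
    closure A `&` closure B !=set0 /\ ~ compact (closure A `&` closure B).

End KappaProperties.

Arguments kurysohn : clear implicits.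
Arguments knormal : clear implicits.

Definition closed_ultrafilter (X : topologicalType) (F : set (set X)) : Prop :=
  [/\ F `<=` closed,
      ~ F set0,
      forall A B, F A -> F B -> F (A `&` B) &
      forall C, closed C -> (forall A, F A -> C `&` A !=set0) -> F C].

Record wallman (X : topologicalType) := Wallman {
  wallman_family : set (set X);
  wallmanP : closed_ultrafilter wallman_family }.

HB.instance Definition _ (X : topologicalType) := gen_eqMixin (wallman X).
HB.instance Definition _ (X : topologicalType) := gen_choiceMixin (wallman X).

Section WallmanTopology.
Variable X : topologicalType.

Definition wallman_basic (U : set X) : set (wallman X) :=
  [set F | exists2 A, wallman_family F A & A `<=` U].

Let wallman_cover : \bigcup_(U in @open X) wallman_basic U = setT.
Proof.
apply/seteqP; split=> // F _; exists setT; first exact: openT.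
case: (wallmanP F) => _ F0 _ Fmax; exists setT => //.
apply: Fmax; first exact: closedT.
move=> A FA; rewrite setTI; apply/set0P/eqP => A0; by apply: F0; rewrite -A0.
Qed.

Let wallman_join (U V : set X) (F : wallman X) :
  open U -> open V -> wallman_basic U F -> wallman_basic V F ->
  exists W, [/\ open W, wallman_basic W F &
                wallman_basic W `<=` wallman_basic U `&` wallman_basic V].
Proof.
move=> oU oV [A FA AU] [B FB BV]; exists (U `&` V); split.
- exact: openI.
- by case: (wallmanP F) => _ _ FI _; exists (A `&` B); [exact: FI|exact: setISS].
- by move=> G [C GC CUV]; split; exists C => // x /CUV [].
Qed.

HB.instance Definition _ :=
  isBaseTopological.Build (wallman X) wallman_cover wallman_join.

End WallmanTopology.

Section WallmanEmbedding.
Variables (X : topologicalType) (X_T1 : accessible_space X).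

(** The T1 hypothesis is what makes this family maximal. *)
Lemma closed_ultrafilter_point (x : X) :
  closed_ultrafilter [set A | closed A /\ A x].
Proof.
split=> [A [] //|[_ //]|A B [Acl Ax] [Bcl Bx]|C Ccl Cmeet].
  by split; [exact: closedI|].
split=> //; have [|y [Cy <-//]] := Cmeet [set x].
by split=> //; exact: accessible_closed_set1.
Qed.

Definition wallman_point (x : X) : wallman X :=
  Wallman (closed_ultrafilter_point x).

End WallmanEmbedding.

Section SubWallman.
Variables (K : Type) (M : set (beta K)).
Variables (X : topologicalType) (X_T1 : accessible_space X).

Definition WM : topologicalType :=
  set_type (Nclosure (hull M) (range (wallman_point X_T1))).

Lemma WM_subproof (x : X) :
  wallman_point X_T1 x \in Nclosure (hull M) (range (wallman_point X_T1)).
Proof. by apply/mem_set; apply: sub_gen_smallest; exists x. Qed.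

Definition jM (x : X) : WM := exist _ (wallman_point X_T1 x) (WM_subproof x).

(** An alias of [WM], so that it can carry the topology [sharp_open] instead. *)
Definition Wsharp : Type := WM.

HB.instance Definition _ := Choice.on Wsharp.

Definition sharp_open (U : set Wsharp) : Prop :=
  open (jM @^-1` U) /\ @Nclosed K (hull M) WM (~` U).

Let sharp_openT : sharp_open setT.
Proof.
split; first by rewrite preimage_setT; exact: openT.
by rewrite setCT; exact: Nclosed_set0.
Qed.

Let sharp_openI : setI_closed sharp_open.
Proof.
move=> U V [oU cU] [oV cV]; split; first by rewrite preimage_setI; exact: openI.
by rewrite setCI; exact: NclosedU.
Qed.

Let sharp_open_bigU (I : Type) (f : I -> set Wsharp) :
  (forall i, sharp_open (f i)) -> sharp_open (\bigcup_i f i).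
Proof.
move=> fo; split.
  by rewrite preimage_bigcup; apply: bigcup_open => i _; case: (fo i).
by rewrite setC_bigcup; apply: Nclosed_bigcap => i _; case: (fo i).
Qed.

HB.instance Definition _ :=
  isOpenTopological.Build Wsharp sharp_openT sharp_openI sharp_open_bigU.

Definition jsharp : X -> Wsharp := jM.

Definition sharp_to_WM : Wsharp -> WM := id.

Definition WM_to_sharp : WM -> Wsharp := id.

End SubWallman.

Definition embedding (X Y : topologicalType) (f : X -> Y) : Prop :=
  [/\ continuous f, injective f &
      forall U : set X, open U ->
        exists2 V : set Y, open V & f @` U = range f `&` V].

Definition is_reflection (T : topologicalType -> Prop) (X TX : topologicalType)
  (i : X -> TX) : Prop :=
  [/\ T TX, continuous i &
      forall (Y : topologicalType) (f : X -> Y), T Y -> continuous f ->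
        exists! g : TX -> Y, continuous g /\ f = g \o i].

Definition class_U (K : Type) (M : set (beta K)) (Y : topologicalType) : Prop :=
  kurysohn K Y /\ Ncompact M Y.

Definition class_H (K : Type) (M : set (beta K)) (Y : topologicalType) : Prop :=
  hausdorff_space Y /\ Ncompact M Y.

(* Main.v *)
Require Import Defs.
From mathcomp Require Import all_boot.
From mathcomp Require Import all_classical.
From mathcomp Require Import topology.

(** Proof idea.  Every point [F] of [W_M X] contains the closure of some set
    [D] of at most kappa points of [X], because kappa * kappa = kappa makes the
    set of such [F] closed under ultralimits.  If [X] is kappa-normal, two
    applications of normality inside the closure of [D] separate distinct
    points in the kappa-Urysohn sense.

    For [f : X -> Y] with [Y] M-compact, call [y] a value at [F] when, for some
    such [D], the closure of [f^-1 O `&` D] belongs to [F] for all open [O]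
    containing [y].  Having a value is preserved by ultralimits, so all points
    of [W_M X] have values.  If values are unique, they define an
    [M]-continuous extension of [f], which is exactly what continuity for the
    sharp topology asks beyond continuity on [X].  Two distinct values would
    give disjoint members of [F] when [Y] is kappa-Urysohn; when [Y] is only
    Hausdorff, they give a butterfly in [X] which, not being long, puts a
    compact set in [F], so that [F] is fixed at some [x] and both values are
    [f x]. *)

Set Implicit Arguments.
Unset Strict Implicit.
Unset Printing Implicit Defensive.

Local Open Scope classical_set_scope.
Local Open Scope card_scope.

(** * The cardinal equality kappa * kappa = kappa *)

Lemma chain_bigcup2 (T : Type) (F : set (set T)) (u v : T) :
  total_on F subset -> (\bigcup_(A in F) A) u -> (\bigcup_(A in F) A) v ->
  exists A, [/\ F A, A u & A v].
Proof.
move=> Ftot [A FA Au] [B FB Bv].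
by have [AB|BA] := Ftot _ _ FA FB; [exists B|exists A]; split=> //;
  [apply: AB|apply: BA].
Qed.

(** Zorn's lemma is applied to the sets [B] whose union with [A0] satisfies [P]: the empty chain,
    whose union need not satisfy [P], then corresponds to [A0] itself. *)
Lemma Zorn_above (T : Type) (P : set (set T)) (A0 : set T) :
  P A0 ->
  (forall F : set (set T), F `<=` P -> F !=set0 -> total_on F subset ->
    P (\bigcup_(A in F) A)) ->
  exists A, [/\ P A, A0 `<=` A & forall B, P B -> A `<=` B -> B `<=` A].
Proof.
move=> PA0 Pchain.
have [F FP Ftot|A [PA Amax]] := @Zorn_bigcup T [set B | P (A0 `|` B)].
  have [->|/set0P F0] := eqVneq F set0; first by rewrite bigcup_set0 /= setU0.
  rewrite /= (_ : A0 `|` _ = \bigcup_(A in [set A0 `|` B | B in F]) A).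
    apply: Pchain => [_ [B /FP PB <-] //||_ _ [B FB <-] [C FC <-]].
      by case: F0 => B FB; exists (A0 `|` B), B.
    by have [|] := Ftot _ _ FB FC; [left|right]; apply: setUS.
  case: F0 => B FB; apply/seteqP; split.
    move=> x [A0x|[C FC Cx]]; first by exists (A0 `|` B); [exists B|left].
    by exists (A0 `|` C); [exists C|right].
  by move=> x [_ [C FC <-] [A0x|Cx]]; [left|right; exists C].
exists (A0 `|` A); split=> // B PB AB x Bx; apply: contrapT => nx.
have A0B : A0 `|` B = B by apply/setUidPr => y A0y; apply: AB; left.
apply: (Amax B); last by rewrite /= A0B.
split=> [y Ay|BA]; first by apply: AB; right.
by apply: nx; right; apply: BA.
Qed.

Definition partial_inj (T U : Type) (A : set T) (B : set U) (G : set (T * U)) :=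
  [/\ forall a b, G (a, b) -> A a /\ B b,
      forall a b b', G (a, b) -> G (a, b') -> b = b' &
      forall a a' b, G (a, b) -> G (a', b) -> a = a'].

Lemma partial_inj_bigcup (T U : Type) (A : set T) (B : set U)
    (F : set (set (T * U))) :
  F `<=` partial_inj A B -> total_on F subset ->
  partial_inj A B (\bigcup_(G in F) G).
Proof.
move=> FP Ftot.
have common u v := @chain_bigcup2 _ F u v Ftot.
split.
- by move=> a b [G /FP[+ _ _]]; apply.
- move=> a b b' /common /[apply] -[G [/FP[_ + _]]]; exact.
- move=> a a' b /common /[apply] -[G [/FP[_ _ +]]]; exact.
Qed.

(** A maximal partial injection is defined on all of [A] or reaches all of [B]; otherwise a missed
    point [a] and a missed point [b] could be paired. *)
Lemma card_le_total (T U : Type) (A : set T) (B : set U) :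
  A #<= B \/ B #<= A.
Proof.
have [G [[GAB Gfun Ginj] Gmax]] :=
  Zorn_bigcup (@partial_inj_bigcup T U A B).
have [Adom|/existsNP[a na]] :=
    pselect (forall a : A, exists b : B, G (val a, val b)).
  left; apply/card_leP/injfunPex; have [f fG] := choice Adom.
  exists f => // a a' _ _ ff; apply: val_inj;
    apply: (Ginj _ _ (val (f a))) => //.
  by rewrite ff.
have [Bran|/existsNP[b nb]] :=
    pselect (forall b : B, exists a : A, G (val a, val b)).
  right; apply/card_leP/injfunPex; have [f fG] := choice Bran.
  exists f => // b b' _ _ ff; apply: val_inj; apply: (Gfun (val (f b))) => //.
  by rewrite ff.
have nGa b' : ~ G (val a, b').
  by move=> Gab; have [_ Bb] := GAB _ _ Gab; apply: na;
    exists (SigSub (mem_set Bb)).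
have nGb a' : ~ G (a', val b).
  by move=> Gab; have [Aa _] := GAB _ _ Gab; apply: nb;
    exists (SigSub (mem_set Aa)).
exfalso; apply: (Gmax (G `|` [set (val a, val b)])).
  split=> [u Gu|GabG]; first by left.
  by apply: (nGa (val b)); apply: GabG; right.
split.
- by move=> a' b' [/GAB //|[-> ->]]; split; apply: set_valP.
- move=> a' b1 b2 [G1|[ea ->]] [G2|[ea' ->]] //; first exact: Gfun G1 G2.
    by rewrite ea' in G1; case: (nGa b1).
  by rewrite ea in G2; case: (nGa b2).
- move=> a1 a2 b' [G1|[-> eb]] [G2|[-> eb']] //; first exact: Ginj G1 G2.
    by rewrite eb' in G1; case: (nGb a1).
  by rewrite eb in G2; case: (nGb a2).
Qed.

(** The graph of an injection of [A * A] into [A], except that a pair may have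
    several images. *)
Definition pairing (K : Type) (A : set K) (G : set (K * K * K)) :=
  [/\ forall a b c, G (a, b, c) -> [/\ A a, A b & A c],
      forall a b, A a -> A b -> exists c, G (a, b, c) &
      forall a b a' b' c, G (a, b, c) -> G (a', b', c) -> a = a' /\ b = b'].

Lemma pairing_bigcup (K : Type) (F : set (set (K * K * K))) :
  F `<=` [set G | exists A, pairing A G] -> total_on F subset ->
  exists A, pairing A (\bigcup_(G in F) G).
Proof.
move=> FP Ftot.
have common u v := @chain_bigcup2 _ F u v Ftot.
(* The graphs do not carry their underlying sets; the diagonal of the union recovers the union of
   these sets. *)
exists [set a | exists c, (\bigcup_(G in F) G) (a, a, c)]; split.
- move=> a b c [G FG Gabc]; have [A [GA Atot _]] := FP _ FG.
  by have [Aa Ab Ac] := GA _ _ _ Gabc; split;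
    [have [d Gd] := Atot _ _ Aa Aa|have [d Gd] := Atot _ _ Ab Ab|
     have [d Gd] := Atot _ _ Ac Ac]; exists d, G.
- move=> a b [c Gaac] [d Gbbd].
  have [G [FG Gac Gbd]] := common _ _ Gaac Gbbd.
  have [A [GA Atot _]] := FP _ FG.
  have [Aa _ _] := GA _ _ _ Gac; have [Ab _ _] := GA _ _ _ Gbd.
  by have [e Ge] := Atot _ _ Aa Ab; exists e, G.
- move=> a b a' b' c /common /[apply] -[G [FG G1 G2]].
  by have [A [_ _ Ginj]] := FP _ FG; apply: Ginj G1 G2.
Qed.

(** With [B := i @` A], the three sets [A * B], [B * A] and [B * B] are injected
    into [B] through [A * A] and the tag [t x y], where [x] and [y] tell which
    of the two coordinates lie in [B]. *)
Section PairingExtend.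
Variables (K : Type) (A : set K) (G : set (K * K * K)) (i : K -> K).
Hypotheses (GA : pairing A G) (iA : forall a, A a -> ~ A (i a))
  (iinj : forall a b, A a -> A b -> i a = i b -> a = b).
Variables (phi : K -> K -> K) (t : bool -> bool -> K).
Hypotheses (phiG : forall a b, A a -> A b -> G (a, b, phi a b))
  (At : forall x y, A (t x y))
  (tinj : forall x y x' y', x || y -> x' || y' -> t x y = t x' y' ->
    x = x' /\ y = y').

Let s (a : K) (x : bool) := if x then i a else a.

Definition pairing_ext : set (K * K * K) := G `|`
  [set u | exists a b x y, [/\ A a, A b, x || y &
    u = (s a x, s b y, i (phi (t x y) (phi a b)))]].

Lemma pairing_extP : pairing (A `|` i @` A) pairing_ext.
Proof.
have [GAA Gtot Ginj] := GA.
have Aphi a b : A a -> A b -> A (phi a b).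
  by move=> Aa Ab; have [] := GAA _ _ _ (phiG Aa Ab).
have phiinj a b a' b' : A a -> A b -> A a' -> A b' ->
    phi a b = phi a' b' -> a = a' /\ b = b'.
  move=> Aa Ab Aa' Ab' e; apply: (Ginj _ _ _ _ (phi a b)); first exact: phiG.
  by rewrite e; exact: phiG.
have sA a x : A a -> (A `|` i @` A) (s a x).
  by move=> Aa; case: x; [right; exists a|left].
have As a : (A `|` i @` A) a -> exists b x, A b /\ a = s b x.
  by case=> [Aa|[b Ab <-]]; [exists a, false|exists b, true].
split.
- move=> a b c [/GAA[Aa Ab Ac]|[a' [b' [x [y [Aa Ab _ [-> -> ->]]]]]]].
    by split; left.
  split; [exact: sA|exact: sA|right].
    by exists (phi (t x y) (phi a' b')) => //; exact/Aphi/Aphi.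
- move=> _ _ /As[a [x [Aa ->]]] /As[b [y [Ab ->]]].
  (* If both coordinates lie in [A], the old graph already provides a value. *)
  have [xy|] := boolP (x || y).
    by exists (i (phi (t x y) (phi a b))); right; exists a, b, x, y.
  case: x y => [] [] //= _; have [c Gc] := Gtot _ _ Aa Ab.
  by exists c; left.
(* Old triples take values in [A] and new ones in the image of [i], which avoids [A]; two new
   triples with the same value share their tag and then their preimages in [A]. *)
- move=> a b a' b' c [G1|[a1 [b1 [x [y [Aa1 Ab1 xy [-> -> ec]]]]]]];
    move=> [G2|[a2 [b2 [x' [y' [Aa2 Ab2 xy' [-> -> ec']]]]]]].
  + exact: Ginj G1 G2.
  + have [_ _] := GAA _ _ _ G1; rewrite ec'.
    by move/iA: (Aphi _ _ (At x' y') (Aphi _ _ Aa2 Ab2)).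
  + have [_ _] := GAA _ _ _ G2; rewrite ec.
    by move/iA: (Aphi _ _ (At x y) (Aphi _ _ Aa1 Ab1)).
  + rewrite ec in ec'.
    have A1 := Aphi _ _ Aa1 Ab1; have A2 := Aphi _ _ Aa2 Ab2.
    have := iinj (Aphi _ _ (At x y) A1) (Aphi _ _ (At x' y') A2) ec'.
    move/(phiinj _ _ _ _ (At _ _) A1 (At _ _) A2) => [/(tinj xy xy')[<- <-]].
    by move/(phiinj _ _ _ _ Aa1 Ab1 Aa2 Ab2) => [<- <-].
Qed.

End PairingExtend.

(** Turns an injection of the subtype [A] into a total function; outside [A] it takes its value at
    [a]. *)
Lemma card_le_inj (T U : Type) (A : set T) (B : set U) (a : T) :
  A a -> A #<= B ->
  exists2 f : T -> U, forall x, A x -> B (f x) &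
    forall x y, A x -> A y -> f x = f y -> x = y.
Proof.
move=> Aa /card_leP/injfunPex[f _ finj].
exists (fun x => if pselect (A x) is left Ax then val (f (SigSub (mem_set Ax)))
  else val (f (SigSub (mem_set Aa)))).
  by move=> x Ax; case: pselect => // ?; exact: set_valP.
move=> x y Ax Ay; case: pselect => // Ax'; case: pselect => // Ay' /val_inj.
by move=> /finj => /(_ (mem_set I) (mem_set I)) [].
Qed.

(** Take a maximal pairing, on a set [A], above one on a countable set. If [A] injected into its
    complement, the pairing could be enlarged; so the complement injects into [A], hence [K] injects
    into [A], and the pairing pulls back to [K]. *)
Lemma infinite_pairing (K : Type) : infinite_set [set: K] ->
  exists phi : K -> K -> K,
    forall a b a' b', phi a b = phi a' b' -> a = a' /\ b = b'.
Proof.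
move=> /infiniteP/(card_le_inj (I : setT 0%N))[e _ einj].
have := card_nat2; rewrite card_eq_le => /andP[+ _].
move=> /(card_le_inj (I : setT (0%N, 0%N)))[p _ pinj].
(* Starting above a copy of the natural numbers guarantees that [A] contains enough distinct
   tags. *)
pose G0 := [set u | exists m n, u = (e m, e n, e (p (m, n)))].
have pG0 : pairing (range e) G0.
  split.
  - by move=> a b c [m [n [-> -> ->]]].
  - by move=> _ _ [m _ <-] [n _ <-]; exists (e (p (m, n))), m, n.
  - move=> a b a' b' c [m [n [-> -> ->]]] [m' [n' [-> ->]]].
    by move=> /(einj _ _ I I)/(pinj _ _ I I)[-> ->].
have [G [[A GA] G0G Gmax]] := Zorn_above (ex_intro _ (range e) pG0 :
    [set G | exists A, pairing A G] G0) (fun F FP _ => @pairing_bigcup K F FP).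
have [GAA Gtot Ginj] := GA.
have Ae n : A (e n).
  have /G0G/GAA[] // : G0 (e n, e n, e (p (n, n))) by exists n, n.
have /choice[phi phiP] : forall u, exists c, A u.1 -> A u.2 -> G (u, c).
  move=> [a b] /=; have [Aa|nAa] := pselect (A a); last by exists a.
  have [Ab|nAb] := pselect (A b); last by exists a.
  by have [c Gc] := Gtot _ _ Aa Ab; exists c.
pose f a b := phi (a, b).
have fG a b : A a -> A b -> G (a, b, f a b) by exact: (phiP (a, b)).
have finj a b a' b' : A a -> A b -> A a' -> A b' ->
    f a b = f a' b' -> a = a' /\ b = b'.
  move=> Aa Ab Aa' Ab' E; apply: (Ginj _ _ _ _ (f a b)); first exact: fG.
  by rewrite E; exact: fG.
have fA a b : A a -> A b -> A (f a b).
  by move=> Aa Ab; have [] := GAA _ _ _ (fG _ _ Aa Ab).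
have [/(card_le_inj (Ae 0%N))[i iA iinj]|] := card_le_total A (~` A).
  pose t (x y : bool) := e (x + y.*2)%N.
  have := @pairing_extP K A G i GA iA iinj f t fG (fun x y => Ae _).
  set H := pairing_ext _ _ _ _ _ => extP.
  have /Gmax HG : exists B, pairing B H.
    exists (A `|` i @` A); apply: extP => x y x' y' _ _ /(einj _ _ I I).
    by case: x x' y y' => [] [] [] [].
  (* By maximality this new triple lies in [G], yet its first coordinate is outside [A]. *)
  have /GAA[/(iA _ (Ae 0%N)) //] :
      G (i (e 0%N), e 0%N, i (f (t true false) (f (e 0%N) (e 0%N)))).
  apply: HG; first by move=> u Gu; left.
  by right; exists (e 0%N), (e 0%N), true, false.
move=> cA.
(* The points of [A] and of its complement are sent into [A] with the distinct tags [e 0] and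
   [e 1]. *)
have [g gA ginj] : exists2 g : K -> K, forall x, A (g x) & injective g.
  have [A0|/set0P[a nAa]] := eqVneq (~` A) set0.
    exists id => // x; apply: contrapT => nAx.
    by have : (~` A) x by []; rewrite A0.
  have [j jA jinj] := card_le_inj nAa cA.
  exists (fun x => if pselect (A x) then f (e 0%N) x else f (e 1%N) (j x)).
    by move=> x; case: pselect => Ax; apply: fA => //; exact: jA.
  have e01 : e 0%N <> e 1%N by move/(einj _ _ I I).
  move=> x y; case: pselect => Ax; case: pselect => Ay.
  - by case/finj.
  - by case/finj => //; exact: jA.
  - by case/finj => //; [exact: jA|move/esym].
  - by case/finj => //; [exact: jA|exact: jA|move=> _ /jinj; exact].
exists (fun a b => f (g a) (g b)) => a b a' b'.
by case/finj => // /ginj -> /ginj ->.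
Qed.

Lemma infinite_unpairing (K : Type) : infinite_set [set: K] ->
  exists u : K -> K * K, forall a b, exists c, u c = (a, b).
Proof.
move=> Kinf; have [phi phiP] := infinite_pairing Kinf.
have /choice[u uP] c : exists ab : K * K, forall a b, phi a b = c -> ab = (a, b).
  have [[a [b <-]]|no] := pselect (exists a b, phi a b = c).
    by exists (a, b) => a' b' /phiP[-> ->].
  by exists (c, c) => a b E; case: no; exists a, b.
by exists u => a b; exists (phi a b); exact: uP.
Qed.

(** * Limits along ultrafilters *)

Section UltrafilterLimitTheory.
Variables (K : Type).
Implicit Types (p q : beta K) (N : set (beta K)).

Lemma beta_filter_setC p (A : set K) :
  ~ beta_filter p A -> beta_filter p (~` A).
Proof. by have pU := beta_ultra p; have [|] := in_ultra_setVsetC A pU. Qed.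

Lemma beta_filter_setCN p (A : set K) :
  beta_filter p A -> ~ beta_filter p (~` A).
Proof.
have pU := beta_ultra p; move=> pA pnA.
by have [k []] := @filter_ex _ (beta_filter p) _ _ (filterI pA pnA).
Qed.

Lemma plimP (Z : topologicalType) p (x : K -> Z) z :
  plim p x z <-> forall U, open U -> U z -> beta_filter p (x @^-1` U).
Proof.
have pU := beta_ultra p; split=> [xz U oU Uz|xz U].
  by apply: xz; exact: open_nbhs_nbhs.
by rewrite nbhsE => -[V [oV Vz] VU]; apply: filterS (xz V oV Vz) => k /VU.
Qed.

Lemma beta_basic_open (A : set K) : open (beta_basic A).
Proof. by exists [set A] => //; exact: bigcup_set1. Qed.

Lemma plim_closed (Z : topologicalType) p (x : K -> Z) (A : set Z) :
  closed A -> beta_filter p (x @^-1` A) -> plim p x `<=` A.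
Proof.
move=> cA pA z /plimP xz; apply: contrapT => nAz.
exact: beta_filter_setCN pA (xz (~` A) (closed_openC cA) nAz).
Qed.

Lemma closed_Nclosed N (Z : topologicalType) (A : set Z) :
  closed A -> Nclosed N A.
Proof.
move=> cA p x _ xA; apply: plim_closed => //; have pU := beta_ultra p.
by apply: filterS (@filterT _ (beta_filter p) _) => k _; exact: xA.
Qed.

(** Redefining [x] by a constant point of [A] off a p-large set keeps its limits and brings all its
    values into [A]. *)
Lemma Nclosed_near N (Z : topologicalType) p (x : K -> Z) (A : set Z) :
  Nclosed N A -> N p -> beta_filter p (x @^-1` A) -> plim p x `<=` A.
Proof.
move=> cA Np pA; have pU := beta_ultra p.
have [k0 Ak0] := @filter_ex _ (beta_filter p) _ _ pA.
pose y k := if pselect (A (x k)) then x k else x k0.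
apply: (@subset_trans _ (plim p y)).
  by apply: plim_eq_near; apply: filterS pA => k /= Ak; rewrite /y;
    case: pselect.
by apply: cA => // k; rewrite /y; case: pselect.
Qed.

(** Each ultrafilter [p] is the limit along [p] of the principal ultrafilters. *)
Lemma sub_hull N : N `<=` hull N.
Proof.
move=> p Np; apply: (Nclosure_closed Np (x := @beta_principal K)).
  by move=> k; apply: sub_gen_smallest; exists k.
apply/plimP => U oU Up; have pU := beta_ultra p.
have [D _ DU] : exists2 D, D `<=` [set: set K] &
  \bigcup_(R in D) beta_basic R = U by [].
move: Up; rewrite -DU => -[R DR pR]; apply: filterS pR => k Rk.
by exists R => //; exact/principal_filterP.
Qed.

Lemma plim_continuous (Y Z : topologicalType) (f : Y -> Z) p x y :
  continuous f -> plim p x y -> plim p (f \o x) (f y).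
Proof.
move=> /continuousP fC /plimP xy; apply/plimP => U oU Ufy.
exact: xy (fC _ oU) Ufy.
Qed.

(** The ultrafilters along which [x] has a limit include the principal ones and form an [N]-closed
    set: if [q] is a limit of [y] along [p] and [z k] is a limit of [x] along [y k], any limit of
    [z] along [p] is a limit of [x] along [q]. *)
Lemma Ncompact_hull N (Z : topologicalType) :
  Ncompact N Z -> Ncompact (hull N) Z.
Proof.
move=> Nco p x Np; move: p Np.
apply: (@smallest_sub _ _ _ [set p | plim p x !=set0])
  => [p y Np yZ q|_ [k _ <-]]; last first.
  exists (x k); apply/plimP => U oU Ux; exact/principal_filterP.
have {yZ}[z yz] := choice yZ; have [z0 /plimP zz0] := Nco p z Np.
move=> /plimP yq; exists z0; apply/plimP => U oU Uz0.
apply: contrapT => /beta_filter_setC qU.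
have pn := yq _ (beta_basic_open _) qU.
have pU := beta_ultra p.
have [k [Uk]] := @filter_ex _ (beta_filter p) _ _ (filterI (zz0 U oU Uz0) pn).
have /plimP /(_ U oU Uk) := yz k; exact: beta_filter_setCN.
Qed.

Lemma plim_unique (Z : topologicalType) p (x : K -> Z) :
  hausdorff_space Z -> is_subset1 (plim p x).
Proof. by move=> hZ; have pU := beta_ultra p; exact: cvg_unique. Qed.

Lemma plim_set_val (Z : topologicalType) (A : set Z) p (x : K -> A) (z : A) :
  plim p x z <-> plim p (set_val \o x) (set_val z).
Proof.
split; first exact/plim_continuous/initial_continuous.
by move=> /plimP xz; apply/plimP => _ [U oU <-] Uz; exact: xz.
Qed.

Lemma Ncompact_Nclosed N (Z : topologicalType) (A : set Z) :
  hausdorff_space Z -> Ncompact N A -> Nclosed N A.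
Proof.
move=> hZ Aco p x Np xA z xz.
have [a] := Aco p (fun k => SigSub (mem_set (xA k))) Np.
move=> /plim_set_val /(plim_unique hZ xz) ->; exact: set_valP.
Qed.

End UltrafilterLimitTheory.

(** * The Wallman extension *)

Section WallmanTheory.
Variable X : topologicalType.
Implicit Types (F G : wallman X) (A B : set X).

Lemma wallman_closed F A : wallman_family F A -> closed A.
Proof. by case: (wallmanP F) => + _ _ _; apply. Qed.

Lemma wallmanI F A B : wallman_family F A -> wallman_family F B ->
  wallman_family F (A `&` B).
Proof. by case: (wallmanP F) => _ _ + _; apply. Qed.

Lemma wallman_neq0 F A : wallman_family F A -> A !=set0.
Proof.
case: (wallmanP F) => _ F0 _ _ FA; apply/set0P/eqP => A0.
by apply: F0; rewrite -A0.
Qed.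

Lemma wallman_meets F A : closed A ->
  (forall B, wallman_family F B -> A `&` B !=set0) -> wallman_family F A.
Proof. by case: (wallmanP F) => _ _ _; apply. Qed.

Lemma wallmanS F A B : A `<=` B -> closed B -> wallman_family F A ->
  wallman_family F B.
Proof.
move=> AB cB FA; apply: wallman_meets => // C FC.
by have [x [Ax Cx]] := wallman_neq0 (wallmanI FA FC); exists x; split=> //;
  exact: AB.
Qed.

Lemma wallman_not F A : closed A -> ~ wallman_family F A ->
  exists2 B, wallman_family F B & A `&` B = set0.
Proof.
move=> cA nFA; apply: contrapT => no; apply: nFA;
  apply: wallman_meets => // B FB.
by apply/set0P/eqP => AB0; apply: no; exists B.
Qed.

Lemma wallman_basicCE F A : closed A ->
  wallman_basic (~` A) F <-> ~ wallman_family F A.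
Proof.
move=> cA; split=> [[B FB BA] FA|/(wallman_not cA)[B FB AB0]].
  by have [x [Bx /(BA _ Bx)]] := wallman_neq0 (wallmanI FB FA).
by exists B => // x Bx Ax; have : set0 x by rewrite -AB0.
Qed.

Lemma wallman_basic_open (U : set X) : open U -> open (wallman_basic U).
Proof. by move=> oU; exists [set U]; [move=> _ ->|exact: bigcup_set1]. Qed.

Lemma wallman_openP (O : set (wallman X)) F : open O -> O F ->
  exists U, [/\ open U, wallman_basic U F & wallman_basic U `<=` O].
Proof.
move=> [D Dopen <-] [U DU UF]; exists U; split=> //; first exact: Dopen.
by move=> G UG; exists U.
Qed.

Lemma closed_wallman_family A : closed A -> closed [set F | wallman_family F A].
Proof.
move=> cA; rewrite -[X in closed X]setCK; apply: open_closedC.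
rewrite (_ : ~` _ = wallman_basic (~` A)).
  exact/wallman_basic_open/closed_openC.
by apply/seteqP; split=> F /(wallman_basicCE F cA).
Qed.

(** Closed ultrafilters are maximal, so distinct ones are not included in each other; a member of
    [F] outside [G] misses some member of [G]. *)
Lemma wallman_neqP F G : F <> G -> exists A B,
  [/\ wallman_family F A, wallman_family G B & A `&` B = set0].
Proof.
move=> FG;
  suff [A FA nGA] : exists2 A, wallman_family F A & ~ wallman_family G A.
  have [B GB AB0] := wallman_not (wallman_closed FA) nGA.
  by exists A, B.
apply: contrapT => no; apply: FG.
have FsubG : wallman_family F `<=` wallman_family G.
  by move=> A FA; apply: contrapT => nGA; apply: no; exists A.
have eFG : wallman_family F = wallman_family G.
  apply/seteqP; split=> // A GA; apply: wallman_meets;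
    first exact: wallman_closed GA.
  by move=> B /FsubG GB; exact: wallman_neq0 (wallmanI GA GB).
move: eFG {no FsubG}; case: F => f pf; case: G => g pg /= E.
by move: pf pg; rewrite E => pf pg; congr Wallman; exact: Prop_irrelevance.
Qed.

Lemma closed_ultrafilter_exists (G0 : set (set X)) :
  (forall A, G0 A -> closed A) -> ~ G0 set0 -> G0 setT ->
  (forall A B, G0 A -> G0 B -> G0 (A `&` B)) ->
  exists F, G0 `<=` wallman_family F.
Proof.
move=> G0cl G00 G0T G0I.
pose P := [set G : set (set X) | [/\ forall A, G A -> closed A, ~ G set0 &
  forall A B, G A -> G B -> G (A `&` B)]].
have [|F FP [H FH] Ftot|G [[Gcl Gn0 GI] G0G Gmax]] :=
    @Zorn_above _ P G0.
- by split.
- split; first by move=> A [G /FP[+ _ _]]; apply.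
    by move=> [G /FP[_ + _]].
  move=> A B /(chain_bigcup2 Ftot)/[apply] -[G [FG GA GB]].
  by exists G => //; have [_ _] := FP _ FG; exact.
have Gultra : closed_ultrafilter G.
  split=> // C cC Cmeet.
  (* The family generated by [G] and [C] still satisfies [P], so maximality puts [C] into [G]. *)
  pose H := [set D | exists2 A, G A & D = A \/ D = C `&` A].
  have Hcl A : H A -> closed A.
    by move=> [B GB [->|->]]; [exact: Gcl|apply: closedI => //; exact: Gcl].
  have /Gmax HG : P H.
    split=> //.
      move=> [B GB [E|E]]; first by apply: Gn0; rewrite E.
      by have := Cmeet _ GB; rewrite -E => -[].
    move=> _ _ [A GA [->|->]] [B GB [->|->]]; exists (A `&` B); try exact: GI.
    - by left.
    - by right; rewrite setICA.
    - by right; rewrite setIA.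
    - by right; rewrite setIACA setIid.
  apply: HG; first by move=> A GA; exists A => //; left.
  by exists setT; [exact: G0G|right; rewrite setIT].
by exists (Wallman Gultra).
Qed.

(** The closed sets that belong to [x k] for p-many [k] are stable under intersection and nonempty;
    any closed ultrafilter [F] containing them is a limit. *)
Lemma wallman_plim (K : Type) (p : beta K) (x : K -> wallman X) :
  plim p x !=set0.
Proof.
have pU := beta_ultra p.
have [||||F GF] := @closed_ultrafilter_exists
    [set A | closed A /\ beta_filter p [set k | wallman_family (x k) A]].
- by move=> A [].
- move=> [_ p0]; have [k] := @filter_ex _ (beta_filter p) _ _ p0.
  by move=> /wallman_neq0 [].
- split; first exact: closedT.
  apply: filterS filterT => k _; apply: wallman_meets; first exact: closedT.
  by move=> B; rewrite setTI; exact: wallman_neq0.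
- move=> A B [cA pA] [cB pB]; split; first exact: closedI.
  by apply: filterS (filterI pA pB) => k [] ; exact: wallmanI.
exists F; apply/plimP => O oO /(wallman_openP oO)[U [oU [A FA AU] UO]].
apply: contrapT => /beta_filter_setC pn.
(* Points outside [O] contain the complement of [U]; being p-many, they put it into [F], against [A]
   inside [U]. *)
have /GF FU : [set A | closed A /\
    beta_filter p [set k | wallman_family (x k) A]] (~` U).
  split; first exact: open_closedC.
  apply: filterS pn => k /= nO; apply: contrapT => nU; apply/nO/UO.
  by have := (wallman_basicCE (x k) (open_closedC oU)).2 nU; rewrite setCK.
by have [y [/AU]] := wallman_neq0 (wallmanI FA FU).
Qed.

End WallmanTheory.

(** * The sharp topology *)

Section SharpTopology.
Variables (K : Type) (M : set (beta K)).
Variables (X : topologicalType) (X_T1 : accessible_space X).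
Local Notation WM := (WM M X_T1).
Local Notation Wsharp := (Wsharp M X_T1).
Local Notation jM := (jM M X_T1).
Local Notation jsharp := (jsharp M X_T1).

Lemma wallman_point_basic (U : set X) x : open U ->
  wallman_basic U (wallman_point X_T1 x) <-> U x.
Proof.
move=> oU; split=> [[A [_ Ax] AU]|Ux]; first exact: AU.
exists [set x]; last by move=> _ ->.
by split=> //; exact: accessible_closed_set1.
Qed.

Lemma continuous_wallman_point : continuous (wallman_point X_T1).
Proof.
apply/continuousP => O oO; rewrite openE => x Ox.
have [U [oU Ux UO]] := wallman_openP oO Ox.
rewrite /interior nbhsE; exists U; first by split=> //;
  exact/wallman_point_basic.
by move=> y Uy; apply: UO; exact/wallman_point_basic.
Qed.

(** Induction principle for [WM]: a property of closed ultrafilters is checked at the points of [X]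
    and along ultralimits. *)
Lemma WM_subset (P : set (wallman X)) : Nclosed (hull M) P ->
  (forall x, P (wallman_point X_T1 x)) -> forall F : WM, P (set_val F).
Proof.
move=> cP Pj F; apply: (smallest_sub cP _ (set_valP F)) => _ [x _ <-];
  exact: Pj.
Qed.

(** [WM] is itself closed under these limits in the Wallman extension, so no limit of points of [A]
    escapes from it. *)
Lemma Nclosed_set_val (A : set WM) :
  Nclosed (hull M) A -> Nclosed (hull M) (set_val @` A : set (wallman X)).
Proof.
move=> cA p x hp xA z xz.
have [y yA] := choice (fun k => let: ex_intro2 w Aw e := xA k in
  ex_intro (fun w => A w /\ set_val w = x k) w (conj Aw e)).
have xE : x = set_val \o y by apply/funext => k /=; case: (yA k).
have zWM : Nclosure (hull M) (range (wallman_point X_T1)) z.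
  apply: (Nclosure_closed hp _ xz) => k; rewrite xE; exact: set_valP.
exists (SigSub (mem_set zWM)) => //.
apply: (cA p y hp); first by move=> k; case: (yA k).
by apply/plim_set_val; rewrite -xE.
Qed.

Lemma jM_Ndense (A : set WM) : Nclosed (hull M) A -> (forall x, A (jM x)) ->
  forall F, A F.
Proof.
move=> /Nclosed_set_val cA Aj F.
have [|G AG /val_inj <- //] := WM_subset cA _ F.
by move=> x; exists (jM x).
Qed.

Lemma continuous_jM : continuous jM.
Proof.
apply/continuousP => _ [O oO <-].
by move/continuousP: continuous_wallman_point => /(_ O oO).
Qed.

Lemma sharp_to_WM_continuous : continuous (@sharp_to_WM K M X X_T1).
Proof.
apply/continuousP => O oO; split.
  by move/continuousP: continuous_jM => /(_ O oO).
apply: closed_Nclosed; exact: open_closedC.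
Qed.

Lemma sharp_basic_open (U : set X) : open U ->
  open [set F : Wsharp | wallman_basic U (set_val (sharp_to_WM F))].
Proof.
move=> oU; have /continuousP := sharp_to_WM_continuous.
move=> /(_ (set_val @^-1` wallman_basic U)); apply.
by exists (wallman_basic U) => //; exact: wallman_basic_open.
Qed.

Lemma sharp_family_closed (A : set X) : closed A ->
  closed [set F : Wsharp | wallman_family (set_val (sharp_to_WM F)) A].
Proof.
move=> cA; rewrite -[X in closed X]setCK; apply: open_closedC.
rewrite (_ : ~` _ =
    [set F : Wsharp | wallman_basic (~` A) (set_val (sharp_to_WM F))]).
  exact/sharp_basic_open/closed_openC.
by apply/seteqP; split=> F;
  have [] := wallman_basicCE (set_val (sharp_to_WM F)) cA.
Qed.

Lemma WM_to_sharp_Ncontinuous : Ncontinuous (hull M) (@WM_to_sharp K M X X_T1).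
Proof.
move=> p x hp _ [z xz <-]; apply/plimP => U [_ cU] Uz.
by apply: contrapT => /beta_filter_setC pn;
  apply: (Nclosed_near cU hp pn xz Uz).
Qed.

Lemma continuous_jsharp : continuous jsharp.
Proof. by apply/continuousP => O []. Qed.

Lemma wallman_point_inj : injective (wallman_point X_T1).
Proof.
move=> x y [E]; have : [set A | closed A /\ A x] [set x].
  by split=> //; exact: accessible_closed_set1.
by rewrite E => -[_ /= ->].
Qed.

Lemma jsharp_inj : injective jsharp.
Proof. by move=> x y /(congr1 val) /wallman_point_inj. Qed.

Lemma jsharp_embedding : embedding jsharp.
Proof.
split; [exact: continuous_jsharp|exact: jsharp_inj|move=> U oU].
exists [set F : Wsharp | wallman_basic U (set_val (sharp_to_WM F))].
  exact: sharp_basic_open.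
apply/seteqP; split.
  move=> _ [x Ux <-]; split; first by exists x.
  exact/(wallman_point_basic _ oU).
by move=> _ [[x _ <-] /(wallman_point_basic _ oU) Ux]; exists x.
Qed.

(** The complement of a sharp open set is closed under ultralimits; if it contains the image of [X],
    it is everything. *)
Lemma jsharp_dense : dense (range jsharp).
Proof.
move=> O [F OF] [_ cO]; apply/set0P/eqP => O0.
suff : (~` O) F by apply.
apply: (jM_Ndense cO) => x Ox.
by have : set0 (jsharp x); [rewrite -O0; split=> //; exists x|].
Qed.

Lemma WM_Ncompact : Ncompact (hull M) WM.
Proof.
move=> p x hp; have [z xz] := wallman_plim p (set_val \o x).
have zWM : Nclosure (hull M) (range (wallman_point X_T1)) z.
  apply: (Nclosure_closed hp _ xz) => k; exact: set_valP.
by exists (SigSub (mem_set zWM)); exact/plim_set_val.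
Qed.

Lemma Wsharp_Ncompact : Ncompact M Wsharp.
Proof.
move=> p x /sub_hull hp; have [z xz] := WM_Ncompact x hp.
by exists z; apply: WM_to_sharp_Ncontinuous => //; exists z.
Qed.

(** Uniqueness of limits makes [A] closed under ultralimits, and its complement pulls back to all of
    [X]: both conditions for a sharp open set hold. *)
Lemma Ncompact_sharp_closed (A : set WM) : hausdorff_space WM ->
  A `<=` ~` range jM -> Ncompact M A ->
  closed (@sharp_to_WM K M X X_T1 @^-1` A).
Proof.
move=> hWM Aj /Ncompact_hull /(Ncompact_Nclosed hWM) cA.
rewrite -[X in closed X]setCK; apply: open_closedC; split;
  last by rewrite setCK.
rewrite (_ : _ @^-1` _ = setT); first exact: openT.
by apply/seteqP; split=> // x _ /Aj; apply; exists x.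
Qed.

End SharpTopology.

(** * Separation and extension of maps *)

(** Nonempty sets of at most kappa points are represented as ranges of maps from [K]; kappa many of
    them fit into one, since [K] maps onto [K * K]. *)
Lemma merge_families (K T : Type) (e : K -> K -> T) : infinite_set [set: K] ->
  exists d : K -> T, forall k, range (e k) `<=` range d.
Proof.
move=> /infinite_unpairing[u uP]; exists (fun c => e (u c).1 (u c).2).
by move=> k _ [l _ <-]; have [c uc] := uP k l; exists c => //; rewrite uc.
Qed.

Lemma merge_pair (K T : Type) (d1 d2 : K -> T) : infinite_set [set: K] ->
  exists d : K -> T, range d1 `<=` range d /\ range d2 `<=` range d.
Proof.
move=> Kinf;
  have [e _ einj] := card_le_inj (I : setT 0%N) ((infiniteP _).1 Kinf).
(* The index [e 0] selects [d1]; every other index, in particular [e 1], selects [d2]. *)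
have [d dP] := @merge_families _ T
  (fun k => if pselect (k = e 0%N) then d1 else d2) Kinf.
exists d; split.
  by have := dP (e 0%N); case: pselect.
have e10 : e 1%N <> e 0%N by move/(einj _ _ I I).
by have := dP (e 1%N); case: pselect.
Qed.

Lemma card_le_range (K T : Type) (C : set T) (t : T) : C #<= [set: K] ->
  exists c : K -> T, C `<=` range c.
Proof.
move=> Cle; have [C0|] := pfcard_geP Cle; first by exists (fun=> t); rewrite C0.
by move=> /surjfunPex[c ->]; exists c.
Qed.

Lemma closure_sub (T : topologicalType) (A B : set T) :
  closed B -> A `<=` B -> closure A `<=` B.
Proof. by move=> cB AB; rewrite closureE; exact: smallest_sub. Qed.

Lemma continuous_closure_preimage (S T : topologicalType) (f : S -> T) A B :
  continuous f -> A `<=` f @^-1` B -> closure A `<=` f @^-1` closure B.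
Proof.
move=> /continuous_closedP fC AB; apply: closure_sub.
  by apply: fC; exact: closed_closure.
by move=> x /AB; exact: (@subset_closure _ B (f x)).
Qed.

Lemma hausdorffP (T : topologicalType) (x y : T) :
  hausdorff_space T -> x <> y ->
  exists V W : set T, [/\ open V, open W, V `&` W = set0, V x & W y].
Proof.
rewrite open_hausdorff => hT /eqP/hT[[V W] /= [/set_mem Vx /set_mem Wy]].
by move=> [oV oW /eqP VW0]; exists V, W.
Qed.

Lemma kurysohn_hausdorff (K : Type) (T : topologicalType) :
  kurysohn K T -> hausdorff_space T.
Proof.
move=> kT; rewrite open_hausdorff => x y /eqP xy.
have [V [W [[oV oW VW0 Vx Wy] _]]] := kT set0 (card_ge0 _ _) x y xy.
by exists (V, W); [split; apply/mem_set|split=> //; apply/eqP].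
Qed.

Lemma dense_eq (S T : topologicalType) (D : set S) (g h : S -> T) :
  dense D -> hausdorff_space T -> continuous g -> continuous h ->
  (forall x, D x -> g x = h x) -> g = h.
Proof.
move=> Dd hT /continuousP gC /continuousP hC gh; apply/funext => x.
apply: contrapT => /(hausdorffP hT)[V [W [oV oW VW0 Vx Wx]]].
have [|y [[Vy Wy] /gh E]] := Dd _ _ (openI (gC _ oV) (hC _ oW)).
  by exists x.
by have : set0 (g y); [rewrite -VW0; split=> //=; rewrite E|].
Qed.

(** The members of [F] generate a filter that has a cluster point in [Q]; being closed, they all
    contain it. *)
Lemma wallman_compact (X : topologicalType) (F : wallman X) (Q : set X) :
  compact Q -> wallman_family F Q ->
  exists x, forall A, wallman_family F A -> A x.
Proof.
move=> cQ FQ.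
have [||x [_ clx]] := cQ (filter_from (wallman_family F) id).
- apply: filter_from_proper => [|A]; last exact: wallman_neq0.
  apply: filter_from_filter; first by exists Q.
  by move=> A B FA FB; exists (A `&` B) => //; exact: wallmanI.
- by exists Q.
exists x => A FA; apply: (wallman_closed FA) => B nB.
by apply: clx => //; exists A.
Qed.

(** * Small sets carrying the points of the extension, and separation *)

Section Extension.
Variables (K : Type) (K_infinite : infinite_set [set: K]) (M : set (beta K)).
Variables (X : topologicalType) (X_T1 : accessible_space X).
Local Notation WM := (WM M X_T1).
Local Notation Wsharp := (Wsharp M X_T1).
Local Notation jM := (jM M X_T1).
Local Notation jsharp := (jsharp M X_T1).

(** Passes to ultralimits: one [d'] absorbs all the ranges, and containing the closure of its range
    is a closed condition on [F]. *)
Lemma WM_closure_range (F : WM) :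
  exists d : K -> X, wallman_family (set_val F) (closure (range d)).
Proof.
move: F; apply: (@WM_subset _ _ _ _
    [set F | exists d : K -> X, wallman_family F (closure (range d))])
  => [p x _ xd|x].
  have [d dx] := choice xd; have [d' dd'] := merge_families d K_infinite.
  move=> F; have pU := beta_ultra p => xF; exists d'.
  apply: plim_closed (closed_wallman_family _) _ _ xF;
    first exact: closed_closure.
  apply: (@filterS _ _ _ setT) => [k _|]; last exact: filterT.
  by apply: wallmanS (dx k); [exact: closureS|exact: closed_closure].
have [k _] := infinite_setN0 K_infinite.
exists (fun=> x); split; first exact: closed_closure.
by apply: subset_closure; exists k.
Qed.

Lemma WM_closure_ranges (F : K -> WM) :
  exists d : K -> X,
    forall k, wallman_family (set_val (F k)) (closure (range d)).
Proof.
have [d dF] := choice (fun k => WM_closure_range (F k)).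
have [d' dd'] := merge_families d K_infinite; exists d' => k.
by apply: wallmanS (dF k); [exact: closureS|exact: closed_closure].
Qed.

Lemma Wsharp_kurysohn : knormal K X -> kurysohn K Wsharp.
Proof.
move=> Xn C Cle F G FG.
have [c Cc] := card_le_range F Cle.
have [dC dCP] := WM_closure_ranges c.
have [dF dFP] := WM_closure_range F; have [dG dGP] := WM_closure_range G.
have [d1 [dCd1 dFd1]] := merge_pair dC dF K_infinite.
(* The closure of the range of this [d] belongs to [F], to [G] and to every point of [C]. *)
have [d [d1d dGd]] := merge_pair d1 dG K_infinite.
pose D := range d.
have cD : closed (closure D) by exact: closed_closure.
have FD : wallman_family (set_val F) (closure D).
  by apply: wallmanS dFP => //; apply: closureS; exact: subset_trans d1d.
have GD : wallman_family (set_val G) (closure D).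
  by apply: wallmanS dGP => //; exact: closureS.
have CD H : C H -> wallman_family (set_val (H : WM)) (closure D).
  move=> /Cc[k _ <-]; apply: wallmanS (dCP k) => //; apply: closureS.
  exact: subset_trans d1d.
have [A [B [FA GB AB0]]] : exists A B, [/\ wallman_family (set_val (F : WM)) A,
    wallman_family (set_val (G : WM)) B & A `&` B = set0].
  by apply: wallman_neqP => /val_inj.
have {}FA := wallmanI FA FD; have {}GB := wallmanI GB GD.
have Dle : D #<= [set: K] by exact: card_image_le.
have [|||V0 [W0 [oV0 oW0 VW0 AV0 BW0]]] :=
    Xn _ Dle _ _ (wallman_closed FA) (wallman_closed GB).
- by move=> x [].
- by move=> x [].
- by rewrite setIACA AB0 set0I.
(* The second separation, of the closure of [V0] from [B], makes even the closures of [V0] and [W2]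
   disjoint inside the closure of [D]; intersecting with [W0] keeps [W2] disjoint from [V0]. *)
have [|||||V1 [W1 [oV1 oW1 VW1 AV1 BW1]]] :=
    Xn _ Dle (closure V0 `&` closure D) (B `&` closure D).
- by apply: closedI => //; exact: closed_closure.
- exact: wallman_closed GB.
- by move=> x [].
- by move=> x [].
- apply/seteqP; split=> // x [[V0x _] /BW0 W0x].
  have [y [V0y W0y]] := V0x _ (open_nbhs_nbhs (conj oW0 W0x)).
  by have : set0 y by rewrite -VW0.
pose W2 := W1 `&` W0.
have oW2 : open W2 by exact: openI.
have VW2 : closure V0 `&` closure D `&` (closure W2 `&` closure D) = set0.
  apply/seteqP; split=> // x [/AV1 V1x [W2x _]].
  have [y [[W1y _] V1y]] := W2x _ (open_nbhs_nbhs (conj oV1 V1x)).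
  by have : set0 y by rewrite -VW1.
exists [set H : Wsharp | wallman_basic V0 (set_val (sharp_to_WM H))].
exists [set H : Wsharp | wallman_basic W2 (set_val (sharp_to_WM H))].
(* Points of [C] contain the closure of [D], so the traces of basic sets on [C] have their closures
   controlled by what happens inside the closure of [D]. *)
have closure_basic U : open U ->
    closure ([set H : Wsharp | wallman_basic U (set_val (sharp_to_WM H))] `&` C)
    `<=` [set H : Wsharp |
      wallman_family (set_val (sharp_to_WM H)) (closure U `&` closure D)].
  move=> oU; apply: closure_sub.
    by apply: sharp_family_closed; apply: closedI => //; exact: closed_closure.
  move=> H [[E HE EU] /CD HD]; apply: wallmanI HD.
  apply: wallmanS HE => //; last exact: closed_closure.
  exact: subset_trans EU (@subset_closure _ _).
split; first split.
- exact: sharp_basic_open.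
- exact: sharp_basic_open.
- apply/seteqP; split=> // H [[E HE EV] [E' HE' EW]].
  have [x [/EV Vx /EW [_ W0x]]] := wallman_neq0 (wallmanI HE HE').
  by have : set0 x by rewrite -VW0.
- by exists (A `&` closure D).
- by exists (B `&` closure D) => // x Bx; split; [exact: BW1|exact: BW0].
apply/seteqP;
  split=> // H [/(closure_basic _ oV0) HV /(closure_basic _ oW2) HW].
by have [x] := wallman_neq0 (wallmanI HV HW); rewrite VW2.
Qed.

(** [y] is a value at [F] of the extension of [f], witnessed by the range of
    [d]: each neighborhood of [y] contains the [f]-image of a part of that
    range whose closure belongs to [F]. *)
Definition approx (Y : topologicalType) (f : X -> Y) (F : wallman X)
    (d : K -> X) (y : Y) :=
  forall O, open O -> O y ->
    wallman_family F (closure (f @^-1` O `&` range d)).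

(** * Extension of continuous maps to [M]-compact spaces *)

Section ToSpace.
Variables (Y : topologicalType) (f : X -> Y).
Hypothesis f_cont : continuous f.

Lemma approx_widen F d d' y : range d `<=` range d' ->
  approx f F d y -> approx f F d' y.
Proof.
move=> dd' Fdy O oO Oy; apply: wallmanS (Fdy O oO Oy).
  by apply: closureS; exact: setIS.
exact: closed_closure.
Qed.

(** For open [O] around [y0], p-many [y k] lie in [O], so p-many [x k] contain the required closure;
    containing it is a closed condition, so the limit [F] contains it too. *)
Lemma approx_plim (p : beta K) (x : K -> wallman X) F
    (d : K -> K -> X) (y : K -> Y) y0 :
  (forall k, approx f (x k) (d k) (y k)) -> plim p x F -> plim p y y0 ->
  exists d', approx f F d' y0.
Proof.
move=> xdy xF /plimP yy0; have [d' dd'] := merge_families d K_infinite.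
exists d' => O oO Oy0; have pU := beta_ultra p.
apply: plim_closed (closed_wallman_family _) _ _ xF;
  first exact: closed_closure.
apply: filterS (yy0 O oO Oy0) => k Oyk.
exact: (approx_widen (dd' k) (xdy k) oO Oyk).
Qed.

Lemma approx_point x : exists d, approx f (wallman_point X_T1 x) d (f x).
Proof.
have [k _] := infinite_setN0 K_infinite.
exists (fun=> x) => O oO Ofx; split; first exact: closed_closure.
by apply: subset_closure; split=> //; exists k.
Qed.

Hypothesis Y_compact : Ncompact M Y.

Lemma approx_exists (F : WM) : exists d y, approx f (set_val F) d y.
Proof.
move: F; apply: (@WM_subset _ _ _ _
    [set F | exists d y, approx f F d y]) => [p x hp xd|x]; last first.
  by have [d dx] := approx_point x; exists d, (f x).
have [d dx] := choice xd; have [y dy] := choice dx.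
move=> F xF; have [y0 yy0] := Ncompact_hull Y_compact y hp.
by have [d' Fd'] := approx_plim dy xF yy0; exists d', y0.
Qed.

Lemma extension : hausdorff_space Y ->
  (forall F d d' y y', approx f F d y -> approx f F d' y' -> y = y') ->
  exists! g : Wsharp -> Y, continuous g /\ f = g \o jsharp.
Proof.
move=> hY uniq.
have [g0 g0P] := choice approx_exists; have [g gP] := choice g0P.
have gf : f = (g : Wsharp -> Y) \o jsharp.
  apply/funext => x; have [d xd] := approx_point x.
  exact: uniq xd (gP (jM x)).
have gC : continuous (g : Wsharp -> Y).
  apply/continuousP => O oO; split.
    rewrite (_ : _ @^-1` _ = f @^-1` O); last by rewrite gf.
    by move/continuousP: f_cont; apply.
  (* A limit [y0] of the values along [x] is a value at the limit [z], so it is [g z] by uniqueness;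
     it stays outside [O] because the complement of [O] is closed. *)
  move=> p x hp xO z xz.
  have [y0 xy0] := Ncompact_hull Y_compact (g \o x) hp.
  have [d zd] := approx_plim (fun k => gP (x k)) ((plim_set_val _ _ _).1 xz) xy0.
  rewrite /setC /preimage /= -(uniq _ _ _ _ _ zd (gP z)).
  have pU := beta_ultra p.
  apply: (plim_closed (open_closedC oO) _ xy0).
  by apply: (@filterS _ _ _ setT) => [k _|]; [exact: xO|exact: filterT].
exists g; split=> // h [hC fh].
apply: (dense_eq (@jsharp_dense K M X X_T1)) => // _ [x _ <-].
by have := congr1 (@^~ x) gf; rewrite fh.
Qed.

End ToSpace.

Lemma approx_unique_kurysohn (Y : topologicalType) (f : X -> Y) F d d' y y' :
  continuous f -> kurysohn K Y ->
  approx f F d y -> approx f F d' y' -> y = y'.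
Proof.
move=> fC kY Fdy Fdy'; apply: contrapT => yy'.
have [e [de d'e]] := merge_pair d d' K_infinite.
(* The Urysohn property is used for the image of the merged range; [f] sends a common point of the
   two members of [F] into both of the disjoint closures. *)
have [V [W [[oV oW _ Vy Wy'] VW0]]] :=
  kY (range (f \o e)) (card_image_le _ _) _ _ yy'.
have FV := approx_widen de Fdy oV Vy; have FW := approx_widen d'e Fdy' oW Wy'.
have sub U : f @^-1` U `&` range e `<=` f @^-1` (U `&` range (f \o e)).
  by move=> x [Ufx [k _ ek]]; split=> //; exists k => //=; rewrite ek.
have [x [xV xW]] := wallman_neq0 (wallmanI FV FW).
have : set0 (f x) by rewrite -VW0; split;
  [exact: continuous_closure_preimage fC (sub V) _ xV|
   exact: continuous_closure_preimage fC (sub W) _ xW].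
by [].
Qed.

Lemma approx_unique_hausdorff (Y : topologicalType) (f : X -> Y) F d d' y y' :
  ~ (exists U V : set X, long_kbutterfly K U V) ->
  continuous f -> hausdorff_space Y ->
  approx f F d y -> approx f F d' y' -> y = y'.
Proof.
move=> noB fC hY Fdy Fdy'; apply: contrapT => yy'.
have [V [W [oV oW VW0 Vy Wy']]] := hausdorffP hY yy'.
pose A := f @^-1` V `&` range d; pose B := f @^-1` W `&` range d'.
have FAB : wallman_family F (closure A `&` closure B).
  by apply: wallmanI; [exact: Fdy|exact: Fdy'].
(* Otherwise the preimages of [V] and [W], with [A] and [B] as their small subsets, form a long
   butterfly. *)
have cAB : compact (closure A `&` closure B).
  apply: contrapT => ncAB; apply: noB; exists (f @^-1` V), (f @^-1` W); split.
    split; [by move/continuousP: fC; apply|by move/continuousP: fC; apply| |].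
      by rewrite -preimage_setI VW0 preimage_set0.
    apply: subset_nonempty (wallman_neq0 FAB).
    by apply: setISS; apply: closureS; exact: subIsetl.
  exists A, B; split; last by split=> //; exact: wallman_neq0 FAB.
  split; [exact: subIsetl|exact: subIsetl| |].
    exact: card_le_trans (subset_card_le (@subIsetr _ _ _)) (card_image_le _ _).
  exact: card_le_trans (subset_card_le (@subIsetr _ _ _)) (card_image_le _ _).
have [x Fx] := wallman_compact cAB FAB.
(* As [x] lies in every member of [F], each neighborhood of [f x] meets each neighborhood of a value
   [z]. *)
have limx e z : approx f F e z -> z = f x.
  move=> Fez; apply: contrapT => /(hausdorffP hY)[O [O' [oO oO' OO' Oz O'fx]]].
  have /Fx xO := Fez O oO Oz.
  have oO'x : open (f @^-1` O') by move/continuousP: fC; apply.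
  have [w [[Ow _] O'w]] := xO _ (open_nbhs_nbhs (conj oO'x O'fx)).
  by have : set0 (f w) by rewrite -OO'.
by apply: yy'; rewrite (limx _ _ Fdy) (limx _ _ Fdy').
Qed.

End Extension.

Theorem theorem10p1 (K : Type) (K_infinite : infinite_set [set: K])
    (M : set (beta K)) (M_nonempty : M !=set0)
    (X : topologicalType) (X_T1 : accessible_space X) :
  (* (1) *) continuous (@sharp_to_WM K M X X_T1) /\
  (* (2) *) Ncontinuous (hull M) (@WM_to_sharp K M X X_T1) /\
  (* (3) *) embedding (jsharp M X_T1) /\
  (* (4) *) dense (range (jsharp M X_T1)) /\
  (* (5) *) Ncompact M (Wsharp M X_T1) /\
  (* (6) *) (knormal K X ->
              hausdorff_space (Wsharp M X_T1) /\
              kurysohn K (Wsharp M X_T1)) /\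
  (* (7) *) (hausdorff_space (WM M X_T1) ->
              forall A : set (WM M X_T1),
                A `<=` ~` range (jM M X_T1) -> Ncompact M A ->
                closed (@sharp_to_WM K M X X_T1 @^-1` A)) /\
  (* (8) *) (forall (Y : topologicalType) (f : X -> Y),
              kurysohn K Y -> Ncompact M Y -> accessible_space Y ->
              continuous f ->
              exists! g : Wsharp M X_T1 -> Y,
                continuous g /\ f = g \o jsharp M X_T1) /\
  (* (9) *) (~ (exists U V : set X, long_kbutterfly K U V) ->
              forall (Y : topologicalType) (f : X -> Y),
                hausdorff_space Y -> Ncompact M Y -> continuous f ->
                exists! g : Wsharp M X_T1 -> Y,
                  continuous g /\ f = g \o jsharp M X_T1) /\
  (* (10) *) (knormal K X ->
              is_reflection (class_U M) (jsharp M X_T1)) /\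
  (* (11) *) (knormal K X ->
              ~ (exists U V : set X, long_kbutterfly K U V) ->
              is_reflection (class_H M) (jsharp M X_T1)).
Proof.
have ext_kurysohn (Y : topologicalType) (f : X -> Y) : kurysohn K Y ->
    Ncompact M Y -> continuous f ->
    exists! g : Wsharp M X_T1 -> Y, continuous g /\ f = g \o jsharp M X_T1.
  move=> kY cY fC; apply: extension => //; first exact: kurysohn_hausdorff kY.
  by move=> F d d' y y'; exact: approx_unique_kurysohn.
have ext_hausdorff (Y : topologicalType) (f : X -> Y) :
    ~ (exists U V : set X, long_kbutterfly K U V) -> hausdorff_space Y ->
    Ncompact M Y -> continuous f ->
    exists! g : Wsharp M X_T1 -> Y, continuous g /\ f = g \o jsharp M X_T1.
  move=> noB hY cY fC; apply: extension => // F d d' y y'.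
  exact: approx_unique_hausdorff.
split; first exact: sharp_to_WM_continuous.
split; first exact: WM_to_sharp_Ncontinuous.
split; first exact: jsharp_embedding.
split; first exact: jsharp_dense.
split; first exact: Wsharp_Ncompact.
split.
  move=> nX; split; last exact: Wsharp_kurysohn.
  by apply: (@kurysohn_hausdorff K); exact: Wsharp_kurysohn.
split; first by move=> hWM A; exact: Ncompact_sharp_closed.
split; first by move=> Y f kY cY _; exact: ext_kurysohn.
split; first by move=> noB Y f; exact: ext_hausdorff.
split=> [nX|nX noB]; split.
- by split; [exact: Wsharp_kurysohn|exact: Wsharp_Ncompact].
- exact: continuous_jsharp.
- by move=> Y f [kY cY]; exact: ext_kurysohn.
- split; last exact: Wsharp_Ncompact.
  by apply: (@kurysohn_hausdorff K); exact: Wsharp_kurysohn.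
- exact: continuous_jsharp.
- by move=> Y f [hY cY]; exact: ext_hausdorff.
Qed.
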